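(* Let $\mathbf{p}=(p_1,\dots,p_k)$ be a probability distribution on $[k]$, let $X_1,\dots,X_M$ be i.i.d. with distribution $\mathbf{p}$, and let $\hat p_i=\frac1M\sum_{j=1}^M\mathbf{1}\{X_j=i\}$ and $\hat{\mathbf{p}}=(\hat p_1,\dots,\hat p_k)$. With $L(\mathbf{q})=\sum_{i=1}^k q_i(1-q_i)$, for every $\epsilon\in(0,2)$, $$\mathbb{P}\left[|L(\hat{\mathbf{p}})-L(\mathbf{p})|\ge \frac1M+\sqrt{\frac{2}{M}\log\frac{2}{\epsilon}}\right]\le\epsilon.$$ In particular, with probability at least $1-\frac1M$, $|L(\hat{\mathbf{p}})-L(\mathbf{p})|\le \frac1M+\sqrt{\frac{2\log(2M)}{M}}$.
   Context: $M\ge 1$ is an integer; $\log$ is the natural logarithm. *)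

(* Defs.v *)
From mathcomp Require Import all_boot all_order all_algebra.
From mathcomp Require Import reals exp.
Set Implicit Arguments. Unset Strict Implicit. Unset Printing Implicit Defensive.
Import Order.TTheory GRing.Theory Num.Theory.
Local Open Scope ring_scope.

Definition Lfun (R : ringType) (k : nat) (q : 'I_k -> R) : R :=
  \sum_(i < k) q i * (1 - q i).

Definition emp (R : fieldType) (k M : nat) (x : {ffun 'I_M -> 'I_k}) : 'I_k -> R :=
  fun i => #|[set j | x j == i]|%:R / M%:R.

Definition prob_iid (R : ringType) (k M : nat) (p : 'I_k -> R)
  (E : pred {ffun 'I_M -> 'I_k}) : R :=
  \sum_(x : {ffun 'I_M -> 'I_k} | E x) \prod_(j < M) p (x j).

(* Main.v *)
Require Import Defs.
From mathcomp Require Import all_boot all_order all_algebra.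
From mathcomp Require Import reals exp.
From mathcomp Require Import lra ring.
From mathcomp Require Import boolp functions normedtype sequences derive realfun.
Import Order.TTheory GRing.Theory Num.Theory.
Import numFieldNormedType.Exports.
Local Open Scope ring_scope.

(** The expected number of colliding pairs [x j = x l] in the sample shows that
    [L (emp x)] has mean [(1 - 1/M) L p], hence a bias between [-1/M] and 0, and
    that altering one sample point moves [L (emp x)] by at most [2/M].
    McDiarmid's inequality with constant [c = 2/M] then bounds each of the two
    tails at level [t] by [exp (- M t^2 / 2)].

    McDiarmid's inequality is obtained by averaging out the coordinates one at
    a time: each averaging keeps the expectation and the bounded differences,
    and by Hoeffding's lemma it costs a factor [exp (s^2 c^2 / 8)] in the
    moment generating function; once all coordinates are averaged out the
    function is constant, equal to its mean. *)

(** * Exponential estimates and Hoeffding's lemma on a finite type *)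

Lemma derive_ge0_homo (R : realType) (f df : R -> R) (a b : R) :
  a <= b -> (forall x, a <= x -> is_derive x 1 f (df x)) ->
  (forall x, a <= x -> 0 <= df x) -> f a <= f b.
Proof.
move=> ab fdf df0.
have [] := @MVT_segment R f df a b ab.
- by move=> x; rewrite in_itv/= => /andP[/ltW ax _]; exact: fdf.
- apply: derivable_within_continuous => x; rewrite in_itv/= => /andP[ax _].
  by have := fdf x ax; case.
- move=> c; rewrite in_itv/= => /andP[ac _] fE.
  by rewrite -subr_ge0 fE mulr_ge0 ?df0// subr_ge0.
Qed.

(** Convexity from tangents: [1 + y <= expR y] at [y = - s u] and at [y = s - s u], averaged with
    weights [1 - u] and [u], gives exactly 1 on the left. *)
Lemma expR_le_chord (R : realType) (s u : R) : 0 <= u <= 1 ->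
  expR (s * u) <= 1 - u + u * expR s.
Proof.
move=> /andP[u0 u1].
have h0 := expR_ge1Dx (- (s * u)).
have h1 := expR_ge1Dx (s - s * u).
have E0 : expR (s * u) * expR (- (s * u)) = 1 by rewrite -expRD subrr expR0.
have E1 : expR (s * u) * expR (s - s * u) = expR s.
  by rewrite -expRD addrC subrK.
have e0 := expR_gt0 (s * u).
set e := expR (s * u) in e0 E0 E1 *.
set a := expR _ in h0 E0; set b := expR (s - _) in h1 E1.
have -> : 1 - u + u * expR s = e * ((1 - u) * a + u * b).
  by rewrite -E1 -[1 - u]mulr1 -[X in _ * X + _]E0; ring.
rewrite ler_peMr ?(ltW e0)//; nra.
Qed.

(* With [D x := 1 - q + q e^x], the function [psi x := x^2/8 + q x - ln (D x)]
   and its derivative [g] vanish at 0, and [psi'' = (1/2 - q e^x / D x)^2]. *)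
Lemma bernoulli_mgf_le (R : realType) (q s : R) : 0 <= q <= 1 -> 0 <= s ->
  1 - q + q * expR s <= expR (s * q + s ^+ 2 / 8).
Proof.
move=> /andP[q0 q1] s0.
pose D (x : R) := 1 - q + q * expR x.
have D0 x : 0 < D x by rewrite /D; have := expR_gt0 x; nra.
have dD (x : R) : is_derive x 1 D (q * expR x).
  have -> : D = cst (1 - q) + q *: expR by apply/funext.
  have h := is_deriveD (is_derive_cst (1 - q) x 1) (is_deriveZ q (is_derive_expR x)).
  by apply: (is_derive_eq h); rewrite add0r.
pose g (x : R) := x / 4 + q - q * expR x / D x.
pose psi (x : R) := x ^+ 2 / 8 + x * q - ln (D x).
have dpsi (x : R) : is_derive x 1 psi (g x).
  have dl := is_derive1_comp (is_derive1_ln (D0 x)) (dD x).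
  have -> : psi = (8^-1 : R) *: (id ^+ 2 : R -> R) + q *: (id : R -> R) - (@ln R \o D).
    by apply/funext => y; rewrite /psi /= mulrC (mulrC y).
  have h := is_deriveB (is_deriveD
    (is_deriveZ 8^-1 (is_deriveX 2 (is_derive_id x 1)))
    (is_deriveZ q (is_derive_id x 1))) dl.
  apply: (is_derive_eq h); rewrite /g /GRing.scale/=.
  by field; rewrite gt_eqF.
have dg (x : R) : is_derive x 1 g ((1 / 2 - q * expR x / D x) ^+ 2).
  have dV := is_deriveV (lt0r_neq0 (D0 x)) (dD x).
  have -> : g = (4^-1 : R) *: (id : R -> R) + cst q - (q *: expR) * (fun y => (D y)^-1).
    by apply/funext => y; rewrite /g /= mulrC.
  have h := is_deriveB (is_deriveD
    (is_deriveZ 4^-1 (is_derive_id x 1)) (is_derive_cst q x 1))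
    (is_deriveM (is_deriveZ q (is_derive_expR x)) dV).
  apply: (is_derive_eq h); rewrite /= /GRing.scale/=.
  have := D0 x; rewrite /D; set e := expR x => /lt0r_neq0 De; by field.
have D00 : D 0 = 1 by rewrite /D expR0 mulr1 subrK.
have g0 x : 0 <= x -> 0 <= g x.
  move=> x0; have -> : 0 = g 0 by rewrite /g expR0 D00 mul0r add0r mulr1 divr1 subrr.
  by apply: (derive_ge0_homo _ _ _ _ _ x0 (fun y _ => dg y)) => y _; exact: sqr_ge0.
have : 0 <= psi s.
  have -> : 0 = psi 0 by rewrite /psi D00 ln1 expr0n /= !mul0r addr0 subr0.
  exact: (derive_ge0_homo _ _ _ _ _ s0 (fun y _ => dpsi y)).
rewrite /psi subr_ge0 => h.
by rewrite -/(D s) -[D s]lnK ?posrE// ler_expR addrC.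
Qed.

(** After rescaling [h] to [u] in [[0, 1]], the chord bound replaces [u] by a Bernoulli variable of
    the same mean [q], which reduces the claim to [bernoulli_mgf_le] at [s * c]. *)
Lemma hoeffding_lemma (R : realType) (T : finType) (p h : T -> R) (c s : R) :
  (forall t, 0 <= p t) -> \sum_t p t = 1 -> 0 < c -> 0 <= s ->
  (forall t t', h t - h t' <= c) ->
  \sum_t p t * expR (s * h t) <=
    expR (s ^+ 2 * c ^+ 2 / 8) * expR (s * \sum_t p t * h t).
Proof.
move=> p0 p1 c0 s0 hc.
(* Total weight 1 forces [T] to be inhabited, so [h] has a minimum. *)
have [t0 _|T0] := pickP (@predT T); last first.
  by move: p1; rewrite big_pred0// => /eqP; rewrite eq_sym oner_eq0.
pose a := h [arg min_(t < t0) h t]%O.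
have ha t : 0 <= h t - a.
  by rewrite /a; case: arg_minP => // i _ hi; rewrite subr_ge0 hi.
pose u t := (h t - a) / c.
have u01 t : 0 <= u t <= 1.
  by rewrite /u divr_ge0 ?ler_pdivrMr ?mul1r ?hc ?ha ?(ltW c0).
have hE t : h t = a + c * u t by rewrite /u; field; rewrite gt_eqF.
pose q := \sum_t p t * u t.
have hq : \sum_t p t * h t = a + c * q.
  rewrite -[a]mul1r -p1 mulr_suml /q mulr_sumr -big_split/=.
  by apply: eq_bigr => t _; rewrite [in LHS]hE; ring.
have q01 : 0 <= q <= 1.
  rewrite sumr_ge0/=; last by move=> t _; rewrite mulr_ge0//; case/andP: (u01 t).
  by rewrite -p1; apply: ler_sum => t _; rewrite ler_piMr//; case/andP: (u01 t).
have sc0 : 0 <= s * c by rewrite mulr_ge0// ltW.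
have -> : expR (s ^+ 2 * c ^+ 2 / 8) * expR (s * \sum_t p t * h t)
        = expR (s * a) * expR (s * c * q + (s * c) ^+ 2 / 8).
  by rewrite -!expRD hq; congr expR; field.
apply: (@le_trans _ _ (expR (s * a) * (1 - q + q * expR (s * c)))); last first.
  by rewrite ler_wpM2l ?expR_ge0 ?bernoulli_mgf_le.
have -> : 1 - q + q * expR (s * c) = \sum_t p t * (1 - u t + u t * expR (s * c)).
  rewrite -[X in X - q]p1 /q mulr_suml -sumrB -big_split/=.
  by apply: eq_bigr => t _; ring.
rewrite mulr_sumr; apply: ler_sum => t _.
rewrite mulrCA ler_wpM2l// hE mulrDr expRD mulrA ler_wpM2l ?expR_ge0//.
exact: expR_le_chord.
Qed.

(** * Finite product measures and McDiarmid's inequality *)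

Section ProductMeasure.
Context {R : realType} {I T : finType}.
Implicit Types (p : T -> R) (f : {ffun I -> T} -> R) (x y : {ffun I -> T}).

Definition expect p f : R :=
  \sum_(x : {ffun I -> T}) (\prod_i p (x i)) * f x.

Definition upd x (i : I) (t : T) : {ffun I -> T} :=
  [ffun j => if j == i then t else x j].

(** The conditional expectation given all coordinates but [i], kept as a function on the whole
    product so that it can be iterated. *)
Definition resample p (i : I) f x : R := \sum_t p t * f (upd x i t).

Lemma upd_id x i t : upd (upd x i t) i (x i) = x.
Proof. by apply/ffunP => j; rewrite !ffunE; case: eqP => [->|]. Qed.

Lemma upd_eq x i t : upd x i t i = t.
Proof. by rewrite ffunE eqxx. Qed.

Lemma upd_neq x i t j : j != i -> upd x i t j = x j.
Proof. by rewrite ffunE => /negPf ->. Qed.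

Lemma expect_cst p (c : R) : \sum_t p t = 1 -> expect p (fun=> c) = c.
Proof.
move=> p1; rewrite /expect -mulr_suml.
by rewrite -(bigA_distr_bigA (fun _ t => p t)) big1 ?mul1r.
Qed.

Lemma ler_expect p f g : (forall t, 0 <= p t) -> (forall x, f x <= g x) ->
  expect p f <= expect p g.
Proof.
by move=> p0 fg; apply: ler_sum => x _; rewrite ler_wpM2l ?prodr_ge0.
Qed.

Lemma expectZ p (c : R) f : expect p (fun x => c * f x) = c * expect p f.
Proof. by rewrite /expect mulr_sumr; apply: eq_bigr => x _; rewrite mulrCA. Qed.

Lemma expectB p f g :
  expect p (fun x => f x - g x) = expect p f - expect p g.
Proof. by rewrite /expect -sumrB; apply: eq_bigr => x _; rewrite mulrBr. Qed.

Lemma expect_sum p (J : finType) (f : J -> {ffun I -> T} -> R) :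
  expect p (fun x => \sum_j f j x) = \sum_j expect p (f j).
Proof.
rewrite /expect exchange_big; apply: eq_bigr => x _.
by rewrite mulr_sumr.
Qed.

(* The pair [(x, t)] has the same weight as [(upd x i t, x i)], and exchanging
   the two is an involution. *)
Lemma expect_resample p i f : \sum_t p t = 1 ->
  expect p (resample p i f) = expect p f.
Proof.
move=> p1; rewrite /expect /resample.
under eq_bigr do rewrite mulr_sumr.
rewrite pair_bigA/=.
pose sw (z : {ffun I -> T} * T) := (upd z.1 i z.2, z.1 i).
have swK : involutive sw.
  by move=> [x t]; rewrite /sw/= upd_id upd_eq.
rewrite (reindex_inj (inv_inj swK))/=.
transitivity (\sum_(z : {ffun I -> T} * T) p z.2 * ((\prod_j p (z.1 j)) * f z.1)).
  apply: eq_bigr => -[x t] _ /=; rewrite upd_id !mulrA; congr (_ * _).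
  rewrite (bigD1 i)//= [in RHS](bigD1 i)//= upd_eq.
  under eq_bigr => j ji do rewrite upd_neq//.
  by rewrite mulrAC mulrA.
rewrite -(pair_bigA _ (fun x t => p t * ((\prod_j p (x j)) * f x)))/=.
by apply: eq_bigr => x _; rewrite -mulr_suml p1 mul1r.
Qed.

(** One-sided, since exchanging [x] and [y] bounds the absolute value. *)
Definition bounded_diff (c : R) f := forall i x y,
  (forall j, j != i -> x j = y j) -> f x - f y <= c.

Lemma resample_bounded_diff p i c f : (forall t, 0 <= p t) -> \sum_t p t = 1 ->
  bounded_diff c f -> bounded_diff c (resample p i f).
Proof.
move=> p0 p1 fc j x y xy; rewrite /resample -sumrB -[c]mul1r -p1 mulr_suml.
apply: ler_sum => t _; rewrite -mulrBr ler_wpM2l//; apply: (fc j) => l lj.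
by rewrite !ffunE; case: ifP => // _; exact: xy.
Qed.

Lemma foldr_resample_bounded_diff p c f (s : seq I) :
  (forall t, 0 <= p t) -> \sum_t p t = 1 ->
  bounded_diff c f -> bounded_diff c (foldr (resample p) f s).
Proof.
by move=> p0 p1 fc; elim: s => //= i s IHs; exact: resample_bounded_diff.
Qed.

(** Each averaging overwrites its coordinate, so the values on [s] are forgotten; for [s = enum I]
    nothing is left to depend on. *)
Lemma eq_foldr_resample p f (s : seq I) x y :
  (forall i, i \notin s -> x i = y i) ->
  foldr (resample p) f s x = foldr (resample p) f s y.
Proof.
elim: s x y => [|i s IHs] x y xy /=.
  by congr f; apply/ffunP => i; exact: xy.
apply: eq_bigr => t _; congr (_ * _); apply: IHs => j js.
by rewrite !ffunE; case: eqVneq => // ji; apply: xy; rewrite inE negb_or ji.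
Qed.

Lemma foldr_resample_enum p f x : \sum_t p t = 1 ->
  foldr (resample p) f (enum I) x = expect p f.
Proof.
move=> p1; have <- : expect p (foldr (resample p) f (enum I)) = expect p f.
  by elim: (enum I) => //= i s <-; exact: expect_resample.
rewrite -[LHS](expect_cst p)//; apply: eq_bigr => y _; congr (_ * _).
by apply: eq_foldr_resample => i; rewrite mem_enum.
Qed.

(** Induction on [r]: averaging the exponential over coordinate [i] keeps its expectation, and
    Hoeffding's lemma moves that average inside the exponent. *)
Lemma mgf_resample p c s f (r : seq I) :
  (forall t, 0 <= p t) -> \sum_t p t = 1 -> 0 < c -> 0 <= s ->
  bounded_diff c f ->
  expect p (fun x => expR (s * f x)) <=
    expR (s ^+ 2 * c ^+ 2 / 8) ^+ size r *
    expect p (fun x => expR (s * foldr (resample p) f r x)).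
Proof.
move=> p0 p1 c0 s0 fc; elim: r => [|i r IHr]/=; first by rewrite mul1r.
apply: (le_trans IHr); rewrite [_ ^+ (size r).+1]exprSr -[leRHS]mulrA.
rewrite ler_wpM2l ?exprn_ge0 ?expR_ge0//.
rewrite -(expect_resample p i)// -expectZ; apply: ler_expect => // x.
apply: hoeffding_lemma => // t t'.
apply: (foldr_resample_bounded_diff p c f r p0 p1 fc i) => j ji.
by rewrite !upd_neq.
Qed.

Lemma mgf_bounded_diff p c s f :
  (forall t, 0 <= p t) -> \sum_t p t = 1 -> 0 < c -> 0 <= s ->
  bounded_diff c f ->
  expect p (fun x => expR (s * f x)) <=
    expR (#|I|%:R * (s ^+ 2 * c ^+ 2 / 8) + s * expect p f).
Proof.
move=> p0 p1 c0 s0 fc.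
apply: (le_trans (mgf_resample p c s f (enum I) p0 p1 c0 s0 fc)).
rewrite expRD expRM_natl -cardE ler_wpM2l ?exprn_ge0 ?expR_ge0//.
rewrite -[leRHS](expect_cst p)//; apply: ler_expect => // x.
by rewrite foldr_resample_enum.
Qed.

Lemma mcdiarmid p c f (t : R) :
  (forall t, 0 <= p t) -> \sum_t p t = 1 -> 0 < c -> (0 < #|I|)%N -> 0 <= t ->
  bounded_diff c f ->
  \sum_(x : {ffun I -> T} | t <= f x - expect p f) \prod_i p (x i) <=
    expR (- (2 * t ^+ 2 / (#|I|%:R * c ^+ 2))).
Proof.
move=> p0 p1 c0 I0 t0 fc; set n : R := #|I|%:R.
have n0 : 0 < n by rewrite ltr0n.
(* The minimizer of the Chernoff exponent [n s^2 c^2 / 8 - s t]. *)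
pose s := 4 * t / (n * c ^+ 2).
have s0 : 0 <= s by rewrite /s divr_ge0 ?mulr_ge0 ?sqr_ge0// ltW.
set mu := expect p f.
(* Markov's inequality for [expR (s * f x)], as a pointwise bound on the indicator. *)
apply: (@le_trans _ _ (expR (- (s * (mu + t))) * expect p (fun x => expR (s * f x)))).
  rewrite -expectZ /expect big_mkcond/=; apply: ler_sum => x _.
  have P0 : 0 <= \prod_i p (x i) by rewrite prodr_ge0.
  case: ifP => [tf|_]; last by rewrite !mulr_ge0 ?expR_ge0.
  rewrite ler_peMr// -expRD -expR0 ler_expR addrC -mulrBr mulr_ge0//; lra.
apply: le_trans; first by apply: ler_wpM2l; [exact: expR_ge0|exact: mgf_bounded_diff fc].
rewrite -expRD ler_expR -/n -/mu le_eqVlt; apply/orP; left; apply/eqP.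
by rewrite /s; field; rewrite !gt_eqF.
Qed.

End ProductMeasure.

(** * The empirical distribution: collisions, bias and tails *)

Section EmpiricalDistribution.
Context {R : realType} {k M : nat} (p : 'I_k -> R).
Context (p0 : forall i, 0 <= p i) (p1 : \sum_i p i = 1) (M0 : (0 < M)%N).
Implicit Types x y : {ffun 'I_M -> 'I_k}.

Let MR0 : 0 < M%:R :> R. Proof. by rewrite ltr0n. Qed.

(** The square of the count of [i] is the number of ordered pairs of draws both equal to [i],
    diagonal included. *)
Lemma Lfun_emp_collisions x :
  Lfun (emp R x) = 1 - M%:R ^- 2 * \sum_j \sum_l (x j == x l)%:R.
Proof.
have cE i : #|[set j | x j == i]|%:R = \sum_j (x j == i)%:R :> R.
  rewrite -sum1dep_card natr_sum [LHS]big_mkcond; apply: eq_bigr => j _.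
  by case: eqP.
have delta j (F : 'I_k -> R) : \sum_i (x j == i)%:R * F i = F (x j).
  rewrite (bigD1 (x j))//= eqxx mul1r big1 ?addr0// => i.
  by rewrite eq_sym => /negPf ->; rewrite mul0r.
rewrite /Lfun; under eq_bigr do rewrite mulrBr mulr1.
rewrite sumrB; congr (_ - _).
  rewrite /emp -mulr_suml; under eq_bigr do rewrite cE.
  rewrite exchange_big/=.
  rewrite (eq_bigr (fun=> 1)) => [|j _]; last first.
    by rewrite -[RHS](delta j (fun=> 1)); apply: eq_bigr => i _; rewrite mulr1.
  by rewrite sumr_const card_ord divff// gt_eqF.
transitivity (M%:R ^- 2 * \sum_i \sum_j (x j == i)%:R * (\sum_l (x l == i)%:R) : R).
  rewrite mulr_sumr; apply: eq_bigr => i _; rewrite -mulr_suml /emp cE.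
  by field; rewrite gt_eqF.
congr (_ * _); rewrite exchange_big; apply: eq_bigr => j _.
rewrite (delta _ (fun i => \sum_l (x l == i)%:R)); apply: eq_bigr => l _.
by rewrite eq_sym.
Qed.

Lemma expect_collision (j l : 'I_M) :
  expect p (fun x => (x j == x l)%:R) =
    if j == l then 1 else \sum_i p i ^+ 2.
Proof.
case: eqVneq => [<-|jl].
  rewrite -[RHS](@expect_cst _ 'I_M _ p)//; apply: eq_bigr => x _.
  by rewrite eqxx.
have lj : l != j by rewrite eq_sym.
(* Independence enters by averaging over the draws [j] and [l] explicitly. *)
rewrite -(expect_resample p j)// -(expect_resample p l)//.
rewrite -[RHS](@expect_cst _ 'I_M _ p)//; apply: eq_bigr => x _; congr (_ * _).
apply: eq_bigr => i _; rewrite expr2; congr (_ * _).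
rewrite /resample (bigD1 i)//= upd_eq upd_neq// upd_eq eqxx mulr1.
rewrite big1 ?addr0// => i' i'i.
by rewrite upd_eq upd_neq// upd_eq (negPf i'i) mulr0.
Qed.

Lemma LfunE : Lfun p = 1 - \sum_i p i ^+ 2.
Proof. by rewrite -p1 -sumrB; apply: eq_bigr => i _; ring. Qed.

(** The [M] diagonal pairs always collide, the other [M (M - 1)] with probability [S], and [1 - (1 +
    (M - 1) S) / M = (1 - 1/M) (1 - S)]. *)
Lemma expect_Lfun_emp :
  expect p (fun x => Lfun (emp R x)) = (1 - M%:R^-1) * Lfun p.
Proof.
rewrite LfunE; set S := \sum_i _.
transitivity (expect p (fun x : {ffun 'I_M -> 'I_k} =>
    1 - M%:R ^- 2 * \sum_j \sum_l (x j == x l)%:R)).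
  by apply: eq_bigr => x _; rewrite Lfun_emp_collisions.
rewrite expectB expectZ expect_cst// expect_sum.
have -> : \sum_(j < M) expect p (fun x : {ffun 'I_M -> 'I_k} =>
    \sum_l (x j == x l)%:R) = M%:R * (1 + (M%:R - 1) * S).
  rewrite -[M in M%:R * _]card_ord mulr_natl -sumr_const; apply: eq_bigr => j _.
  rewrite expect_sum; under eq_bigr do rewrite expect_collision.
  rewrite (bigD1 j)//= eqxx; congr (_ + _).
  under eq_bigr => l lj do rewrite eq_sym (negPf lj).
  rewrite sumr_const -[LHS]mulr_natl cardC1 card_ord -/S; congr (_ * _).
  by rewrite -{2}(prednK M0) -natr1 addrK.
by field; rewrite gt_eqF.
Qed.

(** The sign lets one statement serve both tails. *)
Lemma Lfun_emp_bounded_diff (b : bool) :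
  bounded_diff (2 / M%:R) (fun x => (-1) ^+ b * Lfun (emp R x)).
Proof.
move=> i x y xy; rewrite -mulrBr !Lfun_emp_collisions.
set X := \sum_j _; set Y := \sum_j _.
suff h : `|Y - X| <= 2 * M%:R.
  rewrite (le_trans (ler_norm _))// normrM normrX normrN1 expr1n mul1r.
  have -> : 1 - M%:R ^- 2 * X - (1 - M%:R ^- 2 * Y) = M%:R ^- 2 * (Y - X) by ring.
  rewrite normrM ger0_norm ?invr_ge0 ?sqr_ge0// mulrC.
  rewrite ler_pdivrMr ?exprn_gt0//.
  by have -> : 2 / M%:R * M%:R ^+ 2 = 2 * M%:R :> R by field; rewrite gt_eqF.
rewrite /X /Y -sumrB (le_trans (ler_norm_sum _ _ _))//.
(* Only pairs involving [i] can change; the two indicators cover them and sum to [2 M]. *)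
apply: (@le_trans _ _ (\sum_(j < M) \sum_(l < M) ((j == i)%:R + (l == i)%:R))).
  apply: ler_sum => j _; rewrite -sumrB (le_trans (ler_norm_sum _ _ _))//.
  apply: ler_sum => l _.
  case: (eqVneq j i) => [_|ji]; last case: (eqVneq l i) => [_|li].
  - by case: (_ == _); case: (_ == _); case: (_ == _);
      rewrite ?subrr ?subr0 ?sub0r ?normrN ?normr1 ?normr0 ?addr0 ?add0r
        ?ler01 ?lerDl ?addr_ge0.
  - by case: (_ == _); case: (_ == _);
      rewrite ?subrr ?subr0 ?sub0r ?normrN ?normr1 ?normr0 ?addr0 ?add0r ?ler01.
  - by rewrite !xy// subrr normr0 addr0.
have one : \sum_(l < M) (l == i)%:R = 1 :> R.
  by rewrite (bigD1 i)//= eqxx big1 ?addr0// => l /negPf ->.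
under eq_bigr do rewrite big_split/= one sumr_const card_ord.
by rewrite big_split/= sumrMnl one sumr_const card_ord mulr_natl mulr2n.
Qed.

(** The bias [- L p / M] helps the upper tail; in the lower one the slack [1/M] absorbs it because
    [L p <= 1]. *)
Lemma Lfun_deviation_sub_bias x (t : R) :
  M%:R^-1 + t <= `|Lfun (emp R x) - Lfun p| ->
  exists b : bool, t <= (-1) ^+ b * Lfun (emp R x)
    - expect p (fun x => (-1) ^+ b * Lfun (emp R x)).
Proof.
have L0 : 0 <= Lfun p.
  rewrite sumr_ge0// => i _; rewrite mulr_ge0// subr_ge0 -p1.
  by rewrite (bigD1 i)//= lerDl sumr_ge0.
have L1 : Lfun p <= 1.
  by rewrite LfunE lerBlDr lerDl sumr_ge0// => i _; exact: sqr_ge0.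
have V0 : 0 < (M%:R^-1 : R) by rewrite invr_gt0.
have vL0 : 0 <= M%:R^-1 * Lfun p by rewrite mulr_ge0// ltW.
have vL1 : M%:R^-1 * Lfun p <= M%:R^-1 by rewrite ler_piMr// ltW.
case: (ger0P (Lfun (emp R x) - Lfun p)) => s h.
  by exists false; rewrite expectZ expect_Lfun_emp expr0; lra.
by exists true; rewrite expectZ expect_Lfun_emp expr1; lra.
Qed.

Lemma Lfun_emp_concentration (eps : R) : 0 < eps < 2 ->
  prob_iid p (fun x : {ffun 'I_M -> 'I_k} =>
     M%:R^-1 + Num.sqrt (2 / M%:R * ln (2 / eps))
       <= `|Lfun (emp R x) - Lfun p|) <= eps.
Proof.
move=> /andP[e0 e2]; set t := Num.sqrt _.
pose F (b : bool) x := (-1) ^+ b * Lfun (emp R x).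
pose E b x := t <= F b x - expect p (F b).
(* Here [eps < 2] keeps the radicand nonnegative, so [t] squares back to it. *)
have ln0 : 0 <= ln (2 / eps) by rewrite ln_ge0// ler_pdivlMr// mul1r ltW.
have t2 : t ^+ 2 = 2 / M%:R * ln (2 / eps).
  by rewrite sqr_sqrtr// mulr_ge0// divr_ge0// ltW.
have tail b : \sum_(x : {ffun _} | E b x) \prod_j p (x j) <= eps / 2.
  have := mcdiarmid p (2 / M%:R) (F b) t p0 p1.
  rewrite card_ord divr_gt0// => /(_ isT M0 (sqrtr_ge0 _) (Lfun_emp_bounded_diff b)).
  have -> : 2 * t ^+ 2 / (M%:R * (2 / M%:R) ^+ 2) = ln (2 / eps).
    by rewrite t2; field; rewrite gt_eqF.
  by rewrite -lnV ?posrE ?divr_gt0// lnK ?posrE ?invr_gt0 ?divr_gt0// invf_div.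
(* Union bound over the two signs, each tail having mass at most [eps / 2]. *)
have -> : eps = eps / 2 + eps / 2 by field.
apply: le_trans (lerD (tail false) (tail true)).
rewrite /prob_iid !(big_mkcond (E _)) -big_split big_mkcond/=.
apply: ler_sum => x _; have P0 : 0 <= \prod_j p (x j) by rewrite prodr_ge0.
case: ifP => [/Lfun_deviation_sub_bias [b Eb]|_]; last by rewrite addr_ge0//; case: ifP.
case: b Eb; rewrite -/(F _ _) -/(E _ _) => ->.
  by rewrite lerDr; case: ifP.
by rewrite lerDl; case: ifP.
Qed.

Lemma prob_iidC (A : pred {ffun 'I_M -> 'I_k}) :
  prob_iid p A = 1 - prob_iid p (predC A).
Proof.
rewrite -(expect_cst p 1 p1 : expect p (fun _ : {ffun 'I_M -> 'I_k} => 1) = 1).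
apply/eqP; rewrite eq_sym subr_eq /expect (bigID A)/=.
by under eq_bigr do rewrite mulr1; under [X in _ + X == _]eq_bigr do rewrite mulr1.
Qed.

Lemma le_prob_iid (A B : pred {ffun 'I_M -> 'I_k}) :
  (forall x, A x -> B x) -> prob_iid p A <= prob_iid p B.
Proof.
move=> AB; rewrite /prob_iid [leLHS]big_mkcond [leRHS]big_mkcond.
apply: ler_sum => x _; case: ifPn => [/AB ->//|_].
by case: ifP => // _; rewrite prodr_ge0.
Qed.

End EmpiricalDistribution.

Theorem theorem3 (R : realType) (k M : nat) (p : 'I_k -> R)
  (hp0 : forall i, 0 <= p i) (hp1 : \sum_(i < k) p i = 1) (hM : (0 < M)%N) :
  (forall eps : R, 0 < eps < 2 ->
     prob_iid p (fun x : {ffun 'I_M -> 'I_k} =>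
       M%:R^-1 + Num.sqrt (2 / M%:R * ln (2 / eps))
         <= `|Lfun (emp R x) - Lfun p|) <= eps) /\
  1 - M%:R^-1 <=
     prob_iid p (fun x : {ffun 'I_M -> 'I_k} =>
       `|Lfun (emp R x) - Lfun p|
         <= M%:R^-1 + Num.sqrt (2 * ln (2 * M%:R) / M%:R)).
Proof.
split=> [eps|]; first exact: Lfun_emp_concentration.
have V0 : 0 < (M%:R^-1 : R) by rewrite invr_gt0 ltr0n.
have V1 : (M%:R^-1 : R) < 2.
  by rewrite (@le_lt_trans _ _ 1) ?ltr1n// invf_le1 ?ltr0n ?ler1n.
rewrite prob_iidC// lerD2l lerN2.
(* The choice [eps = 1/M] turns [2 / eps] into [2 M]; the complement is a strict deviation,
   contained in the event already bounded. *)
apply: le_trans (Lfun_emp_concentration p hp0 hp1 hM M%:R^-1 _); last by rewrite V0.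
apply: le_prob_iid => // x /=; rewrite -ltNge invrK => /ltW.
by rewrite mulrAC.
Qed.
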